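(* Let $H$ be a hypergraph with hyperedge multiset $E$, and let $\Gamma$ be a finite abelian group. Let $\mathbf{a}\in\mathbb{R}_{\ge0}^{E}$ be given by $\mathbf{a}_x=|x|-1$. Then the number of nowhere-zero $\Gamma$-flows on $H$ equals $\chi_{P(H)^{*_{\mathbf a}}}(|\Gamma|)$.
   Context: A hypergraph $H=(E,V)$ has a finite vertex set $V$ and a finite multiset $E$ of hyperedges, each a nonempty finite multiset of elements of $V$; $|x|$ denotes the cardinality of $x$ as a multiset. The graph $\mathcal{SG}(H)$ has vertex set $V$; for each hyperedge $x$ choose a vertex $v_x\in x$ and let $E(x)$ consist of, for each vertex $v\ne v_x$ of multiplicity $s$ in $x$, $s$ parallel edges joining $v$ and $v_x$, together with $t-1$ loops at $v_x$, where $t$ is the multiplicity of $v_x$ in $x$ (so $|E(x)|=|x|-1$); the edge set of $\mathcal{SG}(H)$ is the disjoint union of the $E(x)$. $P(H)=(E,r_H)$ where $r_H(S)$ is the rank, in the cycle matroid of $\mathcal{SG}(H)$, of $\bigcup_{x\in S}E(x)$, i.e. the maximum size of an acyclic edge subset (loops are cycles). For a polymatroid $P=(E,r)$ with $r(\{x\})\le\mathbf a_x$ for all $x$, its $\mathbf a$-dual is $P^{*_{\mathbf a}}=(E,r^{*})$ with $r^{*}(S)=r(E-S)+\sum_{x\in S}\mathbf a_x-r(E)$. The characteristic polynomial of a polymatroid $(E,r)$ is $\chi(t)=\sum_{S\subseteq E}(-1)^{|S|}t^{r(E)-r(S)}$. $\mathcal{BG}(H)$ is the directed multigraph on $V\sqcup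 E$ with, for each hyperedge $x$ and vertex $v$ of multiplicity $s$ in $x$, $s$ edges directed from $x$ to $v$. A $\Gamma$-flow on $H$ is a map from edges of $\mathcal{BG}(H)$ to $\Gamma$ such that at every node the sum of incoming values equals the sum of outgoing values; it is nowhere-zero if for every hyperedge $x$ at least one edge incident with $x$ has nonzero value. *)

(* Defs.v *)
From mathcomp Require Import all_boot all_order all_algebra.
From mathcomp Require Import finmap multiset.
From mathcomp Require Import boolp reals exp.

Set Implicit Arguments.
Unset Strict Implicit.
Unset Printing Implicit Defensive.

Import Order.TTheory GRing.Theory Num.Theory.

Local Open Scope mset_scope.
Local Open Scope ring_scope.

(* The multiset of hyperedges is an indexed family: distinct indices may carry
   the same multiset of vertices. *)
Record hypergraph := Hypergraph {
  vertex : finType;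
  hyperedge : finType;
  ends : hyperedge -> {mset vertex};
  ends_neq0 : forall x, ends x != mset0
}.

(* For notions concerning undirected graphs (cycles, rank) the orientation
   recorded by [src] and [tgt] is irrelevant. *)
Record multigraph := Multigraph {
  node : finType;
  edge : finType;
  src : edge -> node;
  tgt : edge -> node
}.

Definition joins (G : multigraph) (e : edge G) (u v : node G) : bool :=
  ((src e == u) && (tgt e == v)) || ((src e == v) && (tgt e == u)).

(* es_i joins vs_i and vs_(i+1), indices being taken cyclically; a loop is a
   cycle of length 1, a pair of parallel edges is a cycle of length 2. *)
Definition is_cycle (G : multigraph) (vs : seq (node G)) (es : seq (edge G)) :
    bool :=
  [&& (0 < size vs)%N, size es == size vs, uniq vs, uniq es &
      all (fun p => joins p.1 p.2.1 p.2.2) (zip es (zip vs (rot 1 vs)))].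

Definition acyclic (G : multigraph) (B : {set edge G}) : Prop :=
  ~ exists vs es, is_cycle vs es /\ {subset es <= B}.

Definition cycle_rank (G : multigraph) (A : {set edge G}) : nat :=
  \max_(B : {set edge G} | (B \subset A) && `[< acyclic B >]) #|B|.

(* The edge (x, w, i) joins w and c x. There are mult(w) of these for
   w != c x, and mult(c x) - 1 (loops) for w = c x. *)
Definition SG (H : hypergraph) (c : hyperedge H -> vertex H) : multigraph :=
  @Multigraph (vertex H)
    {x : hyperedge H & {w : vertex H & 'I_(ends x w - (w == c x))}}
    (fun e => tag (tagged e)) (fun e => c (tag e)).

Definition SG_edges (H : hypergraph) (c : hyperedge H -> vertex H)
    (x : hyperedge H) : {set edge (SG c)} :=
  [set e : edge (SG c) | tag e == x].

(* A polymatroid on E is represented by its rank function {set E} -> R. *)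
Definition rankH (R : realType) (H : hypergraph)
    (c : hyperedge H -> vertex H) (S : {set hyperedge H}) : R :=
  (cycle_rank (\bigcup_(x in S) SG_edges c x))%:R.

Definition pdual (R : realType) (E : finType) (a : E -> R)
    (r : {set E} -> R) (S : {set E}) : R :=
  r (~: S) + \sum_(x in S) a x - r setT.

Definition char_poly_of (R : realType) (E : finType) (r : {set E} -> R)
    (t : R) : R :=
  \sum_(S : {set E}) (-1) ^+ #|S| * t `^ (r setT - r S).

Definition BG (H : hypergraph) : multigraph :=
  @Multigraph (vertex H + hyperedge H)%type
    {x : hyperedge H & {w : vertex H & 'I_(ends x w)}}
    (fun e => inr (tag e)) (fun e => inl (tag (tagged e))).

Definition is_flow (H : hypergraph) (Gam : finZmodType)
    (f : {ffun edge (BG H) -> Gam}) : bool :=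
  [forall n : node (BG H),
    \sum_(e | tgt e == n) f e == \sum_(e | src e == n) f e].

Definition nowhere_zero (H : hypergraph) (Gam : finZmodType)
    (f : {ffun edge (BG H) -> Gam}) : bool :=
  [forall x : hyperedge H, exists e : edge (BG H),
    (src e == inr x) && (f e != 0)].

(* Main.v *)
Require Import Defs.
From HB Require Import structures.
From mathcomp Require Import all_boot all_order all_algebra.
From mathcomp Require Import finmap multiset.
From mathcomp Require Import boolp reals exp.
From mathcomp Require Import ring.

(* By inclusion-exclusion the number of nowhere-zero flows is the alternating
   sum over S of the number of flows vanishing on S. Deleting from each star of
   BG(H) one edge joining x to c x identifies flows on BG(H) with circulations
   on SG(H), because conservation at the node x determines the value on the
   deleted edge. A graph with edge set A has |Gam|^(|A| - rank A) circulations,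
   and |A| - rank A, for A the union of the E(x) with x outside S, equals
   r*(E) - r*(S) for the dual rank function r*. *)

Local Open Scope mset_scope.
Local Open Scope ring_scope.

Set Implicit Arguments.
Unset Strict Implicit.
Unset Printing Implicit Defensive.

Import Order.TTheory GRing.Theory Num.Theory.

(** * Walks in a multigraph *)

Section Chains.
Variable G : multigraph.

(** A walk from [v], where [vs] lists the nodes reached after each edge and omits the start. This
    replaces the rotated [zip] of [is_cycle] by a form suited to induction. *)
Fixpoint chain (v : node G) (es : seq (edge G)) (vs : seq (node G)) : bool :=
  match es, vs with
  | e :: es', w :: vs' => joins e v w && chain w es' vs'
  | [::], [::] => true
  | _, _ => false
  end.

Lemma chainE v es vs : chain v es vs =
  (size es == size vs) &&
  all (fun p => joins p.1 p.2.1 p.2.2) (zip es (zip (v :: vs) vs)).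
Proof.
elim: es v vs => [|e es IHes] v [|w vs] //=.
by rewrite IHes eqSS andbCA.
Qed.

Lemma is_cycle_cons v vs es :
  is_cycle (v :: vs) es = [&& uniq (v :: vs), uniq es & chain v es (rcons vs v)].
Proof.
rewrite /is_cycle chainE rot1_cons size_rcons /=.
rewrite -[v :: rcons _ _]/(rcons (v :: vs) v).
(* [zip] stops at the shorter list, so the extra final [v] is ignored. *)
have -> : zip (v :: vs) (rcons vs v) = zip (rcons (v :: vs) v) (rcons vs v).
  rewrite -[rcons (v :: vs) v]cats1 -{2}[rcons vs v]cats0 zip_cat ?size_rcons //.
  by rewrite cats0.
by case: (size es == _); case: (uniq es); rewrite ?andbF.
Qed.

Lemma chain_take v es vs1 vs2 :
  chain v es (vs1 ++ vs2) -> chain v (take (size vs1) es) vs1.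
Proof.
elim: vs1 v es => [|w vs1 IH] v [|e es] //=.
by case/andP=> -> /IH.
Qed.

Lemma chain_rcons v es vs e w :
  chain v es vs -> joins e (last v vs) w -> chain v (rcons es e) (rcons vs w).
Proof.
elim: es v vs => [|e' es IH] v [|u vs] //= => [_ -> //|].
by case/andP=> -> /IH.
Qed.

Lemma joins_sym (e : edge G) u v : joins e u v = joins e v u.
Proof. by rewrite /joins orbC. Qed.

Lemma joins_incident (e : edge G) u v w :
  joins e u v -> (src e == w) || (tgt e == w) -> (w == u) || (w == v).
Proof.
by case/orP=> /andP[/eqP-> /eqP->]; rewrite ![w == _]eq_sym // orbC.
Qed.

Lemma chain_incident v es vs e w : chain v es vs -> e \in es ->
  (src e == w) || (tgt e == w) -> w \in v :: vs.
Proof.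
elim: es v vs => [|e' es IH] v [|u vs] //= /andP[je ch].
rewrite inE => /predU1P[->|ees] inc.
  by rewrite !inE; case/orP: (joins_incident je inc) => ->; rewrite ?orbT.
by rewrite inE (IH u vs ch ees inc) orbT.
Qed.

Lemma joinsl (e : edge G) u v : joins e u v -> (src e == u) || (tgt e == u).
Proof. by case/orP=> /andP[a b]; rewrite ?a ?b ?orbT. Qed.

(** The first edge is incident with the start [v]; were it used again, [v] would reappear on the
    rest of the walk. *)
Lemma chain_uniq v es vs : chain v es vs -> uniq (v :: vs) -> uniq es.
Proof.
elim: es v vs => [|e es IH] v [|w vs] //= /andP[je ch] /andP[vN uq].
rewrite (IH _ _ ch uq) andbT; apply/negP => ees.
by rewrite (chain_incident ch ees (joinsl je)) in vN.
Qed.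

End Chains.

(** * Circulations with values in a finite abelian group, and how many there are *)

Section Circulations.
Variables (G : multigraph) (Gam : finZmodType).
Implicit Types (f g : {ffun edge G -> Gam}) (A B : {set edge G}).

Definition boundary f : {ffun node G -> Gam} :=
  [ffun v => \sum_(e | src e == v) f e - \sum_(e | tgt e == v) f e].

Fact boundary_is_zmod_morphism : zmod_morphism boundary.
Proof.
move=> f g; apply/ffunP => v; rewrite !ffunE.
under eq_bigr do rewrite !ffunE.
under [X in _ - X = _]eq_bigr do rewrite !ffunE.
by rewrite !sumrB opprD addrACA -opprD.
Qed.

HB.instance Definition _ :=
  GRing.isZmodMorphism.Build {ffun edge G -> Gam} {ffun node G -> Gam}
    boundary boundary_is_zmod_morphism.

Lemma boundary_eq0P f :
  reflect (forall v, \sum_(e | tgt e == v) f e = \sum_(e | src e == v) f e)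
          (boundary f == 0).
Proof.
apply: (iffP eqP) => [/ffunP f0 v|f0].
  by have := f0 v; rewrite !ffunE => /eqP; rewrite subr_eq0 => /eqP.
by apply/ffunP => v; rewrite !ffunE f0 subrr.
Qed.

Definition circulations A : {set {ffun edge G -> Gam}} :=
  [set f | (boundary f == 0) && [forall e, (f e != 0) ==> (e \in A)]].

Lemma circulationsP A f :
  reflect (boundary f = 0 /\ forall e, e \notin A -> f e = 0)
          (f \in circulations A).
Proof.
rewrite inE; apply: (iffP andP) => [[/eqP f0 /forallP fA]|[/eqP f0 fA]]; split=> //.
  by move=> e; apply: contraNeq; have:= fA e => /implyP.
by apply/forallP => e; apply/implyP; apply: contraNT => /fA->.
Qed.

Definition point (T : finType) (x : T) (a : Gam) : {ffun T -> Gam} :=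
  [ffun y => if y == x then a else 0].

Lemma sum_point (T : finType) (P : pred T) x a :
  \sum_(y | P y) point x a y = if P x then a else 0.
Proof.
rewrite big_mkcond (bigD1 x) //= ffunE eqxx big1 ?addr0 // => y /negPf yx.
by rewrite ffunE yx if_same.
Qed.

Lemma pointN (T : finType) (x : T) a : point x (- a) = - point x a.
Proof. by apply/ffunP => y; rewrite !ffunE; case: ifP; rewrite ?oppr0. Qed.

Lemma boundary_point e a : boundary (point e a) = point (src e) a - point (tgt e) a.
Proof.
by apply/ffunP => v; rewrite !ffunE !sum_point ![v == _]eq_sym.
Qed.

(** The value [a] is sent along the walk, with [- a] on edges traversed against their orientation,
    and the boundaries telescope. Distinctness of the edges keeps the values from adding up. *)
Lemma chain_flow v es vs a : chain v es vs -> uniq es ->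
  exists f, [/\ boundary f = point v a - point (last v vs) a,
                forall e, e \notin es -> f e = 0 &
                forall e, e \in es -> f e = a \/ f e = - a].
Proof.
elim: es v vs => [|e es IH] v [|w vs] //=.
  by move=> _ _; exists 0; rewrite raddf0 subrr; split=> // e; rewrite ffunE.
case/andP=> je ch /andP[eN /(IH _ _ ch)[f [bf f0 fa]]].
have [s [bs hs]] : exists s, boundary (point e s) = point v a - point w a /\
    (s = a \/ s = - a).
  case/orP: je => /andP[/eqP se /eqP te].
    by exists a; rewrite boundary_point se te; split; [|left].
  exists (- a); rewrite boundary_point se te !pointN opprK addrC.
  by split; [|right].
exists (point e s + f); split.
- by rewrite raddfD /= bs bf addrA subrK.
- move=> e'; rewrite inE negb_or => /andP[/negPf ne /f0]; rewrite !ffunE ne => ->.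
  by rewrite addr0.
move=> e'; rewrite inE !ffunE => /predU1P[->|e'es].
  by rewrite eqxx f0 // addr0.
case: eqP => [ee|_]; first by rewrite -ee e'es in eN.
by rewrite add0r; apply: fa.
Qed.

(** Around a closed walk the two end terms of [chain_flow] cancel; the result is negated if [e]
    carries [- a]. *)
Lemma cycle_circulation vs es e a : is_cycle vs es -> e \in es ->
  exists2 f, f \in circulations [set e in es] & f e = a.
Proof.
case: vs => // v vs; rewrite is_cycle_cons => /and3P[_ ues ch] ees.
have [f []] := chain_flow a ch ues; rewrite last_rcons subrr => bf f0 fa.
have fC : f \in circulations [set e in es].
  by apply/circulationsP; split=> // e'; rewrite inE; apply: f0.
have [fe|fe] := fa e ees; first by exists f.
exists (- f); last by rewrite ffunE fe opprK.
case/circulationsP: fC => _ fC; apply/circulationsP; split.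
  by rewrite raddfN /= bf oppr0.
by move=> e' /fC; rewrite ffunE => ->; rewrite oppr0.
Qed.

(* Otherwise conservation at [v] would read [f e = 0]. *)
Lemma circulation_other_edge f (e : edge G) v w : boundary f = 0 ->
  joins e v w -> v != w -> f e != 0 ->
  exists e' u, [/\ e' != e, joins e' v u & f e' != 0].
Proof.
move=> bf je nvw fe0; have [e' /and3P[ne inc nf]|none] :=
    pickP (fun e' => [&& e' != e, (src e' == v) || (tgt e' == v) & f e' != 0]).
  exists e', (if src e' == v then tgt e' else src e'); split=> //.
  rewrite /joins; by case: ifP inc => [sv _|_ /= tv]; rewrite ?sv ?tv !eqxx ?orbT.
have zero e' : e' != e -> (src e' == v) || (tgt e' == v) -> f e' = 0.
  by move=> ne inc; have := none e'; rewrite /= ne inc /= => /negbFE/eqP.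
move/ffunP/(_ v): bf; rewrite !ffunE.
(* As [v != w], the edge [e] is not a loop and occurs in only one of the two sums at [v]. *)
case/orP: je => /andP[/eqP se /eqP te].
  rewrite (bigD1 e) ?se //= big1 => [|e' /andP[inc ne]]; last first.
    by apply: zero => //; rewrite inc.
  rewrite big1 => [|e' inc]; last first.
    apply: zero; last by rewrite inc orbT.
    by apply: contraNneq nvw => ee; rewrite -(eqP inc) ee te.
  by rewrite addr0 subr0 => fe; rewrite fe eqxx in fe0.
rewrite [X in _ - X](bigD1 e) ?te //= [X in _ - (_ + X)]big1 => [|e' /andP[inc ne]].
  rewrite big1 => [|e' inc].
    by rewrite addr0 sub0r => /eqP; rewrite oppr_eq0 (negPf fe0).
  apply: zero; last by rewrite inc.
  by apply: contraNneq nvw => ee; rewrite -(eqP inc) ee se.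
by apply: zero => //; rewrite inc orbT.
Qed.

(** The path is prolonged at its start [v] by further edges of the support. Its nodes are distinct
    and finite in number, so some new edge must lead back to the path and close a cycle. *)
Lemma support_chain_cycle f v w vs e es : boundary f = 0 ->
  chain v (e :: es) (w :: vs) -> uniq (v :: w :: vs) ->
  {in e :: es, forall e, f e != 0} ->
  exists vs' es', is_cycle vs' es' /\ {in es', forall e, f e != 0}.
Proof.
move=> bf; have [k] := ubnP (#|node G| - size vs).
elim: k v w vs e es => // k IH v w vs e es ltk ch uq nz.
have /andP[je chw] := ch; have nvw : v != w.
  by move: uq; rewrite /= inE negb_or => /andP[/andP[]].
have [|e' [u [ne je' nz']]] := circulation_other_edge bf je nvw.
  by apply: nz; rewrite mem_head.
have nz'' : {in e' :: e :: es, forall e, f e != 0}.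
  by move=> e1; rewrite inE => /predU1P[->|/nz].
have [uin|uNin] := boolP (u \in v :: w :: vs); last first.
  apply: (IH u v (w :: vs) e' (e :: es)) => //.
  - have: (size (v :: w :: vs) <= #|node G|)%N by rewrite -(card_uniqP uq) max_card.
    rewrite /= ltnS in ltk *; move=> le; apply: leq_trans ltk.
    by rewrite ltn_sub2l // (leq_trans _ le) // ltnW.
  - by rewrite -[chain _ _ _]/(joins e' u v && chain v (e :: es) (w :: vs))
      joins_sym je' ch.
  - by rewrite -[uniq _]/((u \notin v :: w :: vs) && uniq (v :: w :: vs)) uNin uq.
have ue := chain_uniq ch uq.
(* [e'] meets [v], and among the edges of the path only [e] does. *)
have e'N : e' \notin e :: es.
  rewrite inE (negPf ne) /=; apply: contraL uq => e'es.
  by rewrite cons_uniq (chain_incident chw e'es (joinsl je')).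
move: (w :: vs) ch uq uin => p ch uq uin.
(* The initial stretch from [v] to [u], with nodes [v :: p1], is closed up by [e']. When [u = v],
   [p1] is empty and [e'] is a loop. *)
move: ch uq; case/splitPl: uin => p1 p2 lastp1 ch uq.
exists (v :: p1), (rcons (take (size p1) (e :: es)) e'); split; last first.
  move=> e1; rewrite mem_rcons inE => /predU1P[->//|/mem_take]; exact: nz.
rewrite is_cycle_cons; apply/and3P; split.
- by move: uq; rewrite -cat_cons cat_uniq => /and3P[].
- by rewrite rcons_uniq take_uniq // andbT; apply: contra e'N; apply: mem_take.
- by apply: chain_rcons (chain_take ch) _; rewrite lastp1 joins_sym.
Qed.

(** The support of a nonzero circulation contains a cycle: a loop in it is one already, and any
    other edge is a path from which [support_chain_cycle] starts. *)
Lemma circulation_acyclic B f : acyclic B -> f \in circulations B -> f = 0.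
Proof.
move=> acB /circulationsP[bf fB]; apply/ffunP => e; rewrite ffunE.
apply/eqP/negPn/negP => fe0; apply: acB.
suff [vs [es [cyc nz]]] : exists vs es, is_cycle vs es /\ {in es, forall e, f e != 0}.
  exists vs, es; split=> // e' /nz; apply: contraNT => /fB ->.
  by rewrite eqxx.
have je : joins e (src e) (tgt e) by rewrite /joins !eqxx.
have nz : {in [:: e], forall e, f e != 0} by move=> e'; rewrite inE => /eqP->.
have [loop|nloop] := eqVneq (src e) (tgt e).
  by exists [:: src e], [:: e]; split; rewrite // is_cycle_cons /= {2}loop je.
by apply: (@support_chain_cycle f (src e) (tgt e) [::] e [::] bf);
  rewrite //= ?je // inE nloop.
Qed.

Lemma acyclic0 : acyclic (set0 : {set edge G}).
Proof.
case=> -[|v vs] [[|e es] [cyc sub]] //; have := sub e (mem_head _ _).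
by rewrite inE.
Qed.

Lemma cycle_rank_witness A :
  exists B, [/\ B \subset A, acyclic B & #|B| = cycle_rank A].
Proof.
pose P B := (B \subset A) && `[< acyclic B >].
have P0 : P set0 by rewrite /P sub0set; apply/asboolP/acyclic0.
rewrite /cycle_rank (bigop.bigmax_eq_arg set0 P0).
case: arg_maxnP => // B /andP[BA /asboolP acB] _.
by exists B.
Qed.

Lemma cycle_rank_max A B : B \subset A -> acyclic B -> (#|B| <= cycle_rank A)%N.
Proof.
move=> BA acB; rewrite /cycle_rank.
by apply: (leq_bigmax_cond (F := fun B => #|B|)); rewrite BA; apply/asboolP.
Qed.

Lemma cycle_rank_le A : (cycle_rank A <= #|A|)%N.
Proof. by have [B [BA _ <-]] := cycle_rank_witness A; apply: subset_leq_card. Qed.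

(** Since [B] is acyclic, a cycle in [e |: B] must pass through [e], and the value [a] can be sent
    round it. *)
Lemma fundamental_circulation B (e : edge G) a : acyclic B -> ~ acyclic (e |: B) ->
  exists2 f, f \in circulations (e |: B) & f e = a.
Proof.
move=> acB /contrapT[vs [es [cyc sub]]].
have ees : e \in es.
  apply/negPn/negP => eN; apply: acB; exists vs, es; split=> // e' e'es.
  have := sub e' e'es; rewrite !inE => /predU1P[ee|//].
  by rewrite -ee e'es in eN.
have [f /circulationsP[bf f0] fe] := cycle_circulation a cyc ees.
exists f => //; apply/circulationsP; split=> // e' e'N; apply: f0.
by rewrite inE; apply: contra e'N => /sub.
Qed.

(* A circulation is determined by its values off a maximal acyclic set, and
   the fundamental cycles realise any prescription of these values. *)
Theorem card_circulations A :
  #|circulations A| = (#|Gam| ^ (#|A| - cycle_rank A))%N.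
Proof.
have [B [BA acB rB]] := cycle_rank_witness A.
pose D := A :\: B.
pose rho f : {ffun edge G -> Gam} := [ffun e => if e \in D then f e else 0].
have -> : (#|A| - cycle_rank A = #|D|)%N.
  by rewrite -rB /D cardsD (setIidPr BA).
rewrite -[#|Gam|]/(#|Gam : predArgType|) -(card_pffun_on 0 (mem D) predT).
(* Two circulations in [A] that agree on [D] differ by a circulation supported in the acyclic set
   [B]. *)
have rho_inj : {in circulations A &, injective rho}.
  move=> f g /circulationsP[bf fA] /circulationsP[bg gA] /ffunP fg.
  apply/eqP; rewrite -subr_eq0; apply/eqP/(circulation_acyclic acB).
  apply/circulationsP; split; first by rewrite raddfB /= bf bg subrr.
  move=> e eB; rewrite !ffunE; have := fg e; rewrite !ffunE inE eB /=.
  by have [_ ->|eA _] := ifP; rewrite ?subrr // fA ?gA ?eA ?subrr.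
rewrite -(card_in_imset rho_inj); apply: eq_card => h.
apply/imsetP/pffun_onP => [[f fC ->]|[hD _]].
  split=> //; apply/subsetP => e; rewrite inE ffunE.
  by case: ifP => // _; rewrite eqxx.
have [C CP] : exists C : edge G -> {ffun edge G -> Gam},
    forall e, e \in D -> C e \in circulations (e |: B) /\ C e e = h e.
  apply: (@fin_all_exists _ _ (fun e g =>
    e \in D -> g \in circulations (e |: B) /\ g e = h e)).
  move=> e; have [|eN] := boolP (e \in D); last by exists 0.
  rewrite inE => /andP[eB eA].
  have [|g gC ge] := @fundamental_circulation B e (h e) acB; last by exists g.
  (* If [e |: B] were acyclic, it would be an acyclic subset of [A] larger than the rank. *)
  move=> acU; suff: (#|e |: B| <= cycle_rank A)%N.
    by rewrite cardsU1 eB -rB add1n ltnn.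
  by apply: cycle_rank_max => //; rewrite subUset sub1set eA.
(* Each [C e] meets [D] at most in [e], so on [D] the sum takes exactly the values of [h]. *)
exists (\sum_(e in D) C e).
  apply/circulationsP; split.
    rewrite raddf_sum big1 //= => e eD.
    by have [/circulationsP[]] := CP e eD.
  move=> e eA; rewrite sum_ffunE big1 // => e' e'D.
  have [/circulationsP[_ out] _] := CP e' e'D; apply: out.
  apply: contra eA; rewrite !inE => /predU1P[->|]; last exact: (subsetP BA).
  by move: e'D; rewrite inE => /andP[].
apply/ffunP => e; rewrite ffunE; case: ifP => [eD|eN].
  rewrite sum_ffunE (bigD1 e) //= big1 ?addr0; first by have [_ ->] := CP e eD.
  move=> e' /andP[e'D ne]; have [/circulationsP[_ out] _] := CP e' e'D; apply: out.
  by rewrite !inE negb_or eq_sym ne; move: eD; rewrite inE => /andP[].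
apply/eqP/negPn/negP => he; have := subsetP hD e.
by rewrite inE he eN => /(_ isT).
Qed.

End Circulations.

(** * Flows on the hypergraph as circulations of [SG(H)] *)

Section Hypergraph.
Variables (H : hypergraph) (c : hyperedge H -> vertex H).
Hypothesis hc : forall x, c x \in ends x.

Lemma ends_root_gt0 x : (0 < ends x (c x))%N.
Proof. by rewrite -in_mset. Qed.

Lemma last_copy_lt x : ((ends x (c x)).-1 < ends x (c x))%N.
Proof. by rewrite prednK // ends_root_gt0. Qed.

(* The last of the parallel edges from [x] to [c x] is the only edge at [x]
   with no counterpart in [SG c]. *)
Definition to_BG (t : edge (SG c) + hyperedge H) : edge (BG H) :=
  match t with
  | inl (existT x (existT w i)) =>
      existT _ x (existT _ w (widen_ord (leq_subr _ _) i))
  | inr x => existT _ x (existT _ (c x) (Ordinal (last_copy_lt x)))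
  end.

(** [insub] fails only on the last copy of [c x] in [x], since the bound drops below [ends x w] only
    for [w = c x], and then by one. *)
Definition of_BG (b : edge (BG H)) : edge (SG c) + hyperedge H :=
  let: existT x (existT w i) := b in
  match (insub (val i) : option 'I_(ends x w - (w == c x))) with
  | Some j => inl (existT _ x (existT _ w j))
  | None => inr x
  end.

Lemma to_BGK : cancel to_BG of_BG.
Proof.
move=> [[x [w i]]|x] /=; first by rewrite (valK i).
by rewrite insubN // -leqNgt eqxx subn1.
Qed.

Lemma of_BGK : cancel of_BG to_BG.
Proof.
move=> [x [w i]] /=; case: insubP => [j _ ij|] /=.
  by do 2 congr existT; apply: val_inj.
rewrite -leqNgt; have [wc|_] := eqVneq w (c x); last by rewrite subn0 leqNgt ltn_ord.
subst w; rewrite subn1 => le; do 2 congr existT; apply: val_inj => /=.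
by apply/eqP; rewrite eqn_leq le -ltnS prednK ?ends_root_gt0 /=.
Qed.

Lemma to_BG_bij : bijective to_BG.
Proof. by exists of_BG; [exact: to_BGK|exact: of_BGK]. Qed.

Lemma big_BG (T : nmodType) (P : pred (edge (BG H))) (F : edge (BG H) -> T) :
  \sum_(b | P b) F b =
  \sum_(e | P (to_BG (inl e))) F (to_BG (inl e)) +
  \sum_(x | P (to_BG (inr x))) F (to_BG (inr x)).
Proof.
rewrite (reindex to_BG) /=; last by apply: onW_bij; exact: to_BG_bij.
by rewrite big_sumType.
Qed.

Lemma tag_to_BG t :
  tag (to_BG t) = match t with inl e => tag e | inr x => x end.
Proof. by case: t => [[x [w i]]|x]. Qed.

Lemma src_to_BG t :
  src (to_BG t) = inr (match t with inl e => tag e | inr x => x end).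
Proof. by case: t => [[x [w i]]|x]. Qed.

Lemma tgt_to_BG t :
  tgt (to_BG t) = inl (match t with inl e => src e | inr x => c x end).
Proof. by case: t => [[x [w i]]|x]. Qed.

Section Flows.
Variable Gam : finZmodType.
Implicit Types (f : {ffun edge (BG H) -> Gam}) (g : {ffun edge (SG c) -> Gam}).

Definition restrict f : {ffun edge (SG c) -> Gam} :=
  [ffun e => f (to_BG (inl e))].

Definition extend g : {ffun edge (BG H) -> Gam} :=
  [ffun b => match of_BG b with
             | inl e => g e
             | inr x => - \sum_(e : edge (SG c) | tag e == x) g e
             end].

Lemma boundary_inr f x : boundary f (inr x) =
  \sum_(e | tag e == x) restrict f e + f (to_BG (inr x)).
Proof.
rewrite ffunE [X in _ - X]big1 ?subr0; last by move=> [y [w i]].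
rewrite big_BG; congr (_ + _).
  apply: eq_big => [e|e _]; last by rewrite ffunE.
  by rewrite src_to_BG.
rewrite (eq_bigl (pred1 x)) ?big_pred1_eq // => y.
Qed.

(** In [BG H] every edge at [v] enters it, whence the sign. The deleted edges into [v] come from the
    [x] with [c x = v] and carry minus the sum over [E(x)]; these [E(x)] together are the edges of
    [SG c] with target [v]. *)
Lemma boundary_inl f v : (forall x, boundary f (inr x) = 0) ->
  boundary f (inl v) = - boundary (restrict f) v.
Proof.
move=> fx; rewrite !ffunE [X in X - _]big1 ?sub0r; last by move=> [y [w i]].
congr (- _); rewrite big_BG; congr (_ + _).
  apply: eq_big => [e|e _]; last by rewrite ffunE.
  by rewrite tgt_to_BG.
rewrite [in RHS](partition_big (fun e : edge (SG c) => tag e) (fun x => c x == v)) //.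
rewrite -sumrN; apply: eq_big => [x|x /eqP cx]; first by rewrite tgt_to_BG.
have /eqP := fx x; rewrite boundary_inr addrC addr_eq0 => /eqP->.
congr (- _); apply: eq_bigl => e; rewrite andbC; case: eqP => // ex /=.
by move: cx; rewrite tgt_to_BG => -[<-]; rewrite ex eqxx.
Qed.

Lemma restrictK f : (forall x, boundary f (inr x) = 0) -> extend (restrict f) = f.
Proof.
move=> fx; apply/ffunP => b; rewrite ffunE -[in RHS](of_BGK b).
case: (of_BG b) => [e|x]; first by rewrite ffunE.
by have /eqP := fx x; rewrite boundary_inr addrC addr_eq0 => /eqP->.
Qed.

Lemma extendK g : restrict (extend g) = g.
Proof. by apply/ffunP => e; rewrite !ffunE to_BGK. Qed.

Lemma boundary_extend g x : boundary (extend g) (inr x) = 0.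
Proof. by rewrite boundary_inr extendK ffunE to_BGK subrr. Qed.

(** [restrict] is a bijection with inverse [extend]. The supports match because a circulation
    vanishing on [E(x)] is extended by zero on the deleted edge at [x]. *)
Lemma card_BG_circulations (T : {set hyperedge H}) :
  #|circulations (G := BG H) Gam [set b | tag b \in T]| =
  #|circulations Gam (\bigcup_(x in T) SG_edges c x)|.
Proof.
have inU e : (e \in \bigcup_(x in T) SG_edges c x) = (tag e \in T).
  apply/bigcupP/idP => [[x xT]|eT]; first by rewrite inE => /eqP->.
  by exists (tag e); rewrite ?inE.
rewrite -(@card_in_imset _ _ restrict); last first.
  move=> f1 f2 /circulationsP[b1 _] /circulationsP[b2 _] e12.
  by rewrite -(restrictK (f := f1)) ?e12 ?restrictK // => x; rewrite ?b1 ?b2 ffunE.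
apply: eq_card => g; apply/imsetP/circulationsP => [[f /circulationsP[bf fT] ->]|[bg gT]].
  split=> [|e]; last by rewrite inU ffunE => eT; apply: fT; rewrite inE tag_to_BG.
  have fx x : boundary f (inr x) = 0 by rewrite bf ffunE.
  apply/ffunP => v; apply: oppr_inj; rewrite -(boundary_inl v fx) bf.
  by rewrite !ffunE oppr0.
exists (extend g); last by rewrite extendK.
apply/circulationsP; split.
  apply/ffunP => -[v|x]; last by rewrite boundary_extend ffunE.
  rewrite boundary_inl ?extendK ?bg ?ffunE ?oppr0 //; exact: boundary_extend.
move=> b; rewrite inE -{1}[b]of_BGK tag_to_BG ffunE.
case: (of_BG b) => [e|x] eT; first by apply: gT; rewrite inU.
by rewrite big1 ?oppr0 // => e /eqP ex; apply: gT; rewrite inU ex.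
Qed.

End Flows.

(** Both sides count the edges of [BG H] at [x]; the [1] is the deleted edge. *)
Lemma card_SG_edges x : (#|SG_edges c x| + 1 = size (ends x))%N.
Proof.
have -> : size (ends x) = (\sum_w ends x w)%N.
  rewrite -sum1_size (partition_big id predT) //=; apply: eq_bigr => w _.
  by rewrite -big_filter sum1_size size_filter -count_mem_mset.
have -> : (\sum_w ends x w = \sum_(b : edge (BG H) | tag b == x) 1)%N.
  rewrite (eq_bigl (fun b => (tag b == x) && true)) => [|b]; last by rewrite andbT.
  rewrite -(@sig_big_dep _ _ _ _ _ (pred1 x) (fun _ => predT) (fun _ _ => 1%N)) /=.
  rewrite big_pred1_eq.
  rewrite -(@sig_big_dep _ _ _ _ _ predT (fun _ => predT) (fun _ _ => 1%N)) /=.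
  by apply: eq_bigr => w _; rewrite sum1_card card_ord.
rewrite (big_BG (fun b => tag b == x) (fun=> 1%N)); congr (_ + _)%N.
  by rewrite -sum1_card; apply: eq_bigl => e; rewrite inE tag_to_BG.
by rewrite (eq_bigl (pred1 x)) ?big_pred1_eq.
Qed.

Lemma card_bigcup_SG_edges (T : {set hyperedge H}) :
  #|\bigcup_(x in T) SG_edges c x| = (\sum_(x in T) #|SG_edges c x|)%N.
Proof.
rewrite -sum1_card (partition_big (fun e : edge (SG c) => tag e) (mem T)) /=.
  apply: eq_bigr => x xT; rewrite -sum1_card; apply: eq_bigl => e.
  rewrite inE; case: eqP => [ex|]; rewrite ?andbF ?andbT //.
  by apply/bigcupP; exists x; rewrite ?inE ?ex.
by move=> e /bigcupP[x xT]; rewrite inE => /eqP->.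
Qed.

End Hypergraph.

(** * Inclusion-exclusion over the hyperedges on which a flow vanishes *)

Lemma sum_subset_sign (R : comNzRingType) (E : finType) (Z : {set E}) :
  \sum_(S : {set E}) (-1) ^+ #|S| * (S \subset Z)%:R = (Z == set0)%:R :> R.
Proof.
have prodb (D : {pred E}) : \prod_(x in D) (x \in Z)%:R = (D \subset Z)%:R :> R.
  have [DZ|/subsetPn[x xD xZ]] := boolP (D \subset Z).
    by rewrite big1 // => x /(subsetP DZ)->.
  by rewrite (bigD1 x) //= (negPf xZ) mul0r.
(* Expanding the product by choosing one of the two terms at each [x] gives the signed sum; an
   element of [Z] makes its factor zero. *)
transitivity (\prod_(x : E) (- (x \in Z)%:R + 1 : R)).
  rewrite bigA_distr; apply: eq_big => // S _.
  by rewrite -big_mkcond /= prodrN prodb.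
have [->|/set0Pn[x xZ]] := eqVneq Z set0.
  by rewrite big1 // => x _; rewrite inE oppr0 add0r.
by rewrite (bigD1 x) //= xZ addNr mul0r.
Qed.

(** After exchanging the sums, a flow [f] is weighted by the signed count of the [S] contained in
    its vanishing set [zero f], which is 1 if that set is empty and 0 otherwise. *)
Lemma card_nowhere_zero_flows (R : comNzRingType) (H : hypergraph)
    (Gam : finZmodType) :
  #|[set f : {ffun edge (BG H) -> Gam} | is_flow f && nowhere_zero f]|%:R =
  \sum_(S : {set hyperedge H}) (-1) ^+ #|S| *
    #|circulations (G := BG H) Gam [set b | tag b \in ~: S]|%:R :> R.
Proof.
pose zero (f : {ffun edge (BG H) -> Gam}) :=
  [set x | [forall b : edge (BG H), (tag b == x) ==> (f b == 0)]].
have nzE f : nowhere_zero f = (zero f == set0).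
  apply/forallP/eqP => [nz|z0 x].
    apply/setP => x; rewrite !inE; apply/negP => /forallP z.
    have /existsP[b /andP[/eqP[bx] /negP]] := nz x.
    by apply; have := z b; rewrite bx eqxx.
  have /negbT : (x \in zero f) = false by rewrite z0 inE.
  rewrite inE negb_forall => /existsP[b]; rewrite negb_imply => /andP[/eqP<- fb].
  by apply/existsP; exists b; rewrite fb andbT.
have flowE f : is_flow f = (boundary f == 0).
  by apply/forallP/boundary_eq0P => fl v; apply/eqP/fl.
have circE S f : (f \in circulations (G := BG H) Gam [set b | tag b \in ~: S]) =
    is_flow f && (S \subset zero f).
  rewrite flowE inE; congr andb; apply/forallP/subsetP => [fS x xS|Sz b].
    rewrite inE; apply/forallP => b; apply/implyP => /eqP bx; have := fS b.
    by rewrite !inE bx xS implybF negbK.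
  apply/implyP; apply: contraR; rewrite !inE negbK => /Sz; rewrite inE.
  by move/forallP/(_ b); rewrite eqxx.
have cardE S : #|circulations (G := BG H) Gam [set b | tag b \in ~: S]|%:R =
    \sum_(f | is_flow f) (S \subset zero f)%:R :> R.
  rewrite -sum1_card natr_sum (eq_bigl _ _ (circE S)) big_mkcondr.
  by apply: eq_bigr => f _; case: (S \subset _).
under [RHS]eq_bigr => S _ do rewrite cardE mulr_sumr.
rewrite exchange_big /= -sum1_card natr_sum.
under eq_bigl => f do rewrite inE nzE.
rewrite big_mkcondr; apply: eq_bigr => f _; rewrite sum_subset_sign.
by case: (zero f == set0).
Qed.

(** * Comparison with the characteristic polynomial of the dual *)

Theorem theorem8p4 (R : realType) (H : hypergraph)
    (c : hyperedge H -> vertex H) (hc : forall x, c x \in ends x)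
    (Gam : finZmodType) :
  #|[set f : {ffun edge (BG H) -> Gam} | is_flow f && nowhere_zero f]|%:R =
  char_poly_of (pdual (fun x => (size (ends x))%:R - 1) (rankH R c))
    (#|Gam|%:R).
Proof.
rewrite card_nowhere_zero_flows; apply: eq_bigr => S _; congr (_ * _).
rewrite (card_BG_circulations hc) card_circulations natrX.
set A := \bigcup_(x in ~: S) _; rewrite -powR_mulrn ?ler0n //; congr (_ `^ _).
(* This is where the choice of the vector [a] enters: [|x| - 1] is the size of [E(x)]. *)
have cardA : \sum_(x in ~: S) ((size (ends x))%:R - 1) = #|A|%:R :> R.
  rewrite (card_bigcup_SG_edges c) natr_sum; apply: eq_bigr => x _.
  by rewrite -(card_SG_edges hc) natrD addrK.
have rank0 : rankH R c set0 = 0.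
  rewrite /rankH big_set0; apply/eqP; rewrite pnatr_eq0 -leqn0.
  by have := cycle_rank_le (set0 : {set edge (SG c)}); rewrite cards0.
rewrite natrB ?cycle_rank_le // /pdual setCT rank0.
(* In the difference of the dual ranks, the sum of [a] over [S] and the rank of the whole set
   cancel. *)
rewrite (big_setID S) setTI setTD /= cardA.
rewrite -[rankH R c (~: S)]/(cycle_rank A)%:R.
ring.
Qed.
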